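(* Let $X$ be a locally compact, connected Hausdorff space, let $\nu$ be a deficient topological measure on $X$, and let $m=\widetilde\nu^{+}$ be the associated measure defined in the context. The following are equivalent: (a) $\nu$ is singleton-finite. (b) $\widetilde\nu$ is compact-finite. (c) $m$ is compact-finite.
   Context: $\mathscr{O}(X)$, $\mathscr{C}(X)$, $\mathscr{K}(X)$ denote the collections of open, closed, compact subsets of $X$; $\sqcup$ denotes a disjoint union. Set functions into the extended reals are assumed not identically $\infty$. A deficient topological measure is $\nu:\mathscr{C}(X)\cup\mathscr{O}(X)\to[0,\infty]$ such that: $\nu(C\sqcup K)=\nu(C)+\nu(K)$ for disjoint compact $C,K$; $\nu(U)=\sup\{\nu(C): C\subseteq U, C\in\mathscr{K}(X)\}$ for $U$ open; $\nu(F)=\inf\{\nu(U): F\subseteq U, U\in\mathscr{O}(X)\}$ for $F$ closed. For such $\nu$ define $\widetilde\nu:\mathscr{K}(X)\to[0,\infty]$ by $\widetilde\nu(K)=\inf\{\sum_{i=1}^n\nu(K_i):K\subseteq\bigcup_{i=1}^nK_i, K_i\in\mathscr{K}(X), n\in\mathbb{N}\}$, and define $m=\widetilde\nu^{+}$ on $\mathscr{O}(X)\cup\mathscr{C}(X)$ by $\widetilde\nu^{+}(U)=\sup\{\widetilde\nu(K):K\subseteq U,K\in\mathscr{K}(X)\}$ for $U$ open and $\widetilde\nu^{+}(F)=\inf\{\widetilde\nu^{+}(U):F\subseteq U,U\in\mathscr{O}(X)\}$ for $F$ closed. ($m$ is the restriction to $\mathscr{O}(X)\cup\mathscr{C}(X)$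 of a Borel measure that is inner regular on open sets and outer regular.) A set function is singleton-finite if it is finite on each $\{x\}$, $x\in X$, and compact-finite if it is finite on each compact set. *)

(* Defs.v *)
From HB Require Import structures.
From mathcomp Require Import all_boot all_order all_algebra.
From mathcomp Require Import all_classical all_reals all_analysis.

Set Implicit Arguments.
Unset Strict Implicit.
Unset Printing Implicit Defensive.

Import Order.TTheory GRing.Theory Num.Theory.
Local Open Scope classical_set_scope.
Local Open Scope ring_scope.
Local Open Scope ereal_scope.

Section set_functions.
Context {R : realType} {X : topologicalType}.
Implicit Types (nu lambda : set X -> \bar R) (A C D F K U : set X).

(* Only the values of nu on open and on closed sets are constrained or used;
   nu is arbitrary on the other subsets of X. *)
Record deficient_topological_measure nu : Prop := DeficientTopologicalMeasure {
  dtm_ge0 : forall A, open A \/ closed A -> 0 <= nu A ;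
  dtm_not_infty : exists2 A, open A \/ closed A & nu A != +oo ;
  dtm_additive : forall C K, compact C -> compact K -> C `&` K = set0 ->
    nu (C `|` K) = nu C + nu K ;
  dtm_inner_open : forall U, open U ->
    nu U = ereal_sup [set nu C | C in [set C | compact C /\ C `<=` U]] ;
  dtm_outer_closed : forall F, closed F ->
    nu F = ereal_inf [set nu U | U in [set U | open U /\ F `<=` U]] }.

Definition dtm_tilde nu K : \bar R :=
  ereal_inf [set s | exists (n : nat) (C : nat -> set X),
    [/\ (0 < n)%N, forall i, (i < n)%N -> compact (C i),
        K `<=` \bigcup_(i < n) C i & s = \sum_(i < n) nu (C i)]].

Definition plus_open lambda U : \bar R :=
  ereal_sup [set lambda K | K in [set K | compact K /\ K `<=` U]].

Definition plus_closed lambda F : \bar R :=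
  ereal_inf [set plus_open lambda U | U in [set U | open U /\ F `<=` U]].

(* Clopen sets are covered by both formulas, which then agree, see
   set_plus_closedE; the value on sets neither open nor closed is junk. *)
Definition set_plus lambda A : \bar R :=
  if `[< open A >] then plus_open lambda A else plus_closed lambda A.

Lemma set_plus_openE lambda U : open U -> set_plus lambda U = plus_open lambda U.
Proof. by move=> oU; rewrite /set_plus asboolT. Qed.

Lemma set_plus_closedE lambda F :
  closed F -> set_plus lambda F = plus_closed lambda F.
Proof.
rewrite /set_plus; case: asboolP => // oF _; apply/eqP; rewrite eq_le.
apply/andP; split; last by apply: ereal_inf_lbound => /=; exists F => /=; first split.
apply: le_ereal_inf_tmp => _ [U [oU FU] <-].
apply: ereal_sup_le => _ [K [cK KF] <-].
by exists K => //; split=> //; exact: subset_trans FU.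
Qed.

Definition singleton_finite nu : Prop := forall x : X, nu [set x] \is a fin_num.

Definition compact_finite nu : Prop :=
  forall K, compact K -> nu K \is a fin_num.

End set_functions.

(* Main.v *)
Require Import Defs.
From mathcomp Require Import all_boot all_order all_algebra.
From mathcomp Require Import all_classical all_reals all_analysis.

Import Order.TTheory GRing.Theory Num.Theory.

(** Write [t] for [dtm_tilde nu] and [m] for [set_plus t].

    The finiteness of [t] on compact sets is a local question: [t] is monotone,
    is finite on a union of two sets where it is finite, and is at most [nu] on
    compact sets, so by compactness it suffices that each point has a compact
    neighbourhood of finite [nu]-value.  If [nu [set x]] is finite, outer
    regularity gives an open set around [x] with finite value, and local
    compactness a compact neighbourhood inside it.

    To pass from [t] to [m], enclose a compact set in the interior of a compact
    set [C]: its [m]-value is then at most [t C].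

    To return from [m] to [nu], note that on a singleton the infimum defining [t]
    gains nothing over [nu]: one member of a finite cover of [[set x]] by compact
    sets contains [x], and [nu] is monotone.  So
    [nu [set x] <= t [set x] <= m [set x]]. *)

Local Open Scope classical_set_scope.
Local Open Scope ereal_scope.

(** Compactness as an induction principle: if [P K] failed, the complements in
    [K] of the sets satisfying [P] would generate a proper filter
    without cluster point in [K]. *)
Lemma compact_ind {X : topologicalType} (P : set X -> Prop) (K : set X) :
  P set0 -> (forall A B, A `<=` B -> P B -> P A) ->
  (forall A B, P A -> P B -> P (A `|` B)) ->
  (forall x, K x -> exists2 N, nbhs x N & P N) ->
  compact K -> P K.
Proof.
move=> P0 PS PU Ploc cK; apply: contrapT => nPK.
pose F : set_system X := [set A | P (K `\` A)].
have FP : ProperFilter F.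
  apply: Build_ProperFilter; first by rewrite /F /= setD0.
  split=> [|A B FA FB|A B AB]; rewrite /F /=.
  - by rewrite setDT.
  - by rewrite setDIr; exact: PU.
  - by apply: PS; exact: setDS.
have FK : F K by rewrite /F /= setDv.
have [x [Kx clx]] := cK F FP FK.
have [N xN PN] := Ploc x Kx.
have FN : F (~` N) by rewrite /F /= setDE setCK; apply: PS PN => y [].
by have [y [nNy Ny]] := clx _ _ FN xN.
Qed.

Lemma locally_compact_nbhs {X : topologicalType} (x : X) :
  locally_compact [set: X] -> exists2 V, nbhs x V & compact V.
Proof. by move=> /(_ x I) [V]; rewrite withinET => xV [cV _]; exists V. Qed.

Lemma compact_nbhs_subset {X : topologicalType} (x : X) (U : set X) :
  locally_compact [set: X] -> hausdorff_space X -> nbhs x U ->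
  exists C, [/\ nbhs x C, compact C & C `<=` U].
Proof.
move=> lcX hX xU; have [V xV cV] := locally_compact_nbhs x lcX.
have [B xB BU] := compact_regular hX cV xV xU.
exists (V `&` closure B); split.
- by apply: filterI => //; apply: filterS xB; exact: subset_closure.
- by apply: compact_closedI => //; exact: closed_closure.
- by move=> y [_ /BU].
Qed.

Lemma compact_sub_interior_compact {X : topologicalType} (K : set X) :
  locally_compact [set: X] -> compact K ->
  exists2 C, compact C & K `<=` C^°.
Proof.
move=> lcX; apply: (compact_ind (fun A => exists2 C, compact C & A `<=` C^°)).
- by exists set0; [exact: compact0|exact: sub0set].
- by move=> A B AB [C cC BC]; exists C => //; exact: subset_trans BC.
- move=> A B [C cC AC] [D cD BD]; exists (C `|` D); first exact: compactU.
  move=> y [/AC|/BD]; apply: interiorS; [exact: subsetUl|exact: subsetUr].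
- move=> x _; have [V xV cV] := locally_compact_nbhs x lcX.
  by exists V^°; [exact: nbhs_interior|exists V].
Qed.

Section deficient_topological_measure_theory.
Context {R : realType} {X : topologicalType}.
Context (hausX : hausdorff_space X).
Context (nu : set X -> \bar R) (hnu : deficient_topological_measure nu).

Lemma dtm_compact_ge0 (C : set X) : compact C -> 0 <= nu C.
Proof. by move=> cC; apply: (dtm_ge0 hnu); right; exact: compact_closed. Qed.

Lemma dtm_compact_le_open (C U : set X) :
  compact C -> open U -> C `<=` U -> nu C <= nu U.
Proof.
move=> cC oU CU; rewrite (dtm_inner_open hnu oU).
by apply: ereal_sup_ubound; exists C.
Qed.

Lemma dtm_le_compact (C K : set X) :
  compact C -> compact K -> C `<=` K -> nu C <= nu K.
Proof.
move=> cC cK CK; rewrite (dtm_outer_closed hnu (compact_closed hausX cK)).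
apply: le_ereal_inf_tmp => _ [U [oU KU] <-].
by apply: dtm_compact_le_open => //; exact: subset_trans KU.
Qed.

(** Additivity gives [nu set0 = nu set0 + nu set0], so the value is [0] or
    [+oo]; the latter would, by monotonicity, make [nu] equal to [+oo] on all
    open and all closed sets. *)
Lemma dtm_set0 : nu set0 = 0.
Proof.
have c0 : compact (@set0 X) by exact: compact0.
have open_fin : exists2 U, open U & nu U < +oo.
  have [A [oA|cA]] := dtm_not_infty hnu; rewrite -ltey => nA; first by exists A.
  move: nA; rewrite (dtm_outer_closed hnu cA).
  by move=> /ereal_inf_lt [_ [U [oU _] <-] ?]; exists U.
have [U oU nU] := open_fin.
have f0 : nu set0 \is a fin_num.
  rewrite ge0_fin_numE ?dtm_compact_ge0//; apply: le_lt_trans nU.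
  by apply: dtm_compact_le_open => //; exact: sub0set.
have := dtm_additive hnu c0 c0 (setI0 _); rewrite setU0 -(fineK f0) => -[].
by move=> /eqP; rewrite -subr_eq subrr => /eqP <-.
Qed.

Lemma dtm_tilde_ge0 (A : set X) : 0 <= dtm_tilde nu A.
Proof.
apply: le_ereal_inf_tmp => _ [n [C [_ cC _ ->]]].
by apply: sume_ge0 => i _; apply: dtm_compact_ge0; exact: cC.
Qed.

Lemma dtm_tilde_le (A B : set X) :
  A `<=` B -> dtm_tilde nu A <= dtm_tilde nu B.
Proof.
move=> AB; apply: le_ereal_inf_tmp => _ [n [C [n0 cC BC ->]]].
by apply: ereal_inf_lbound; exists n, C; split=> //; exact: subset_trans BC.
Qed.

Lemma dtm_tilde_le_dtm (C : set X) : compact C -> dtm_tilde nu C <= nu C.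
Proof.
move=> cC; apply: ereal_inf_lbound; exists 1%N, (fun=> C); split=> //.
- by move=> y Cy; exists 0%N.
- by rewrite big_ord1.
Qed.

Lemma dtm_tildeU_lty (A B : set X) :
  dtm_tilde nu A < +oo -> dtm_tilde nu B < +oo -> dtm_tilde nu (A `|` B) < +oo.
Proof.
move=> /ereal_inf_lt[_ [n [C [n0 cC AC ->]]] finC].
move=> /ereal_inf_lt[_ [p [D [p0 cD BD ->]]] finD].
apply: (@le_lt_trans _ _ (\sum_(i < n) nu (C i) + \sum_(i < p) nu (D i)));
  last exact: lte_add_pinfty.
pose E i := if (i < n)%N then C i else D (i - n)%N.
apply: ereal_inf_lbound; exists (n + p)%N, E; split.
- by rewrite addn_gt0 n0.
- move=> i inp; rewrite /E; case: (ltnP i n) => [/cC//|ni].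
  by apply: cD; rewrite ltn_subLR.
- move=> y [/AC [i /= ilt Ciy]|/BD [i /= ilt Diy]].
    by exists i; [exact: ltn_addr|rewrite /E ilt].
  exists (n + i)%N; first by rewrite /= ltn_add2l.
  by rewrite /E ltnNge leq_addr /= addKn.
- rewrite big_split_ord /=; congr (_ + _); apply: eq_bigr => i _; rewrite /E.
    by rewrite ltn_ord.
  by rewrite ltnNge leq_addr /= addKn.
Qed.

(** Some member of a finite compact cover of [[set x]] contains [x], and by
    monotonicity its [nu]-value alone is already at least [nu [set x]]. *)
Lemma dtm_le_dtm_tilde_set1 (x : X) : nu [set x] <= dtm_tilde nu [set x].
Proof.
apply: le_ereal_inf_tmp => _ [n [C [_ cC xC ->]]].
have [i /= ilt Cix] := xC x erefl.
rewrite (bigD1 (Ordinal ilt)) //=.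
apply: (@le_trans _ _ (nu (C i))).
  by apply: dtm_le_compact => //; [exact: compact_set1|exact: cC|move=> _ ->].
by rewrite leeDl// sume_ge0// => j _; apply: dtm_compact_ge0; exact: cC.
Qed.

(** The property of having finite [dtm_tilde nu]-value is hereditary, stable under
    finite unions and, by outer regularity at points, local; compact sets inherit
    it by [compact_ind]. *)
Lemma dtm_tilde_compact_lty (K : set X) :
  locally_compact [set: X] -> singleton_finite nu -> compact K ->
  dtm_tilde nu K < +oo.
Proof.
move=> lcX nu1; apply: (compact_ind (fun A => dtm_tilde nu A < +oo)).
- by rewrite (le_lt_trans (dtm_tilde_le_dtm _ compact0))// dtm_set0.
- by move=> A B AB; apply: le_lt_trans; exact: dtm_tilde_le.
- exact: dtm_tildeU_lty.
move=> x _; have := nu1 x; rewrite ge0_fin_numE; last first.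
  by apply: dtm_compact_ge0; exact: compact_set1.
rewrite (dtm_outer_closed hnu (compact_closed hausX (@compact_set1 _ x))).
move=> /ereal_inf_lt[_ [U [oU xU] <-] finU].
have [C [xC cC CU]] := compact_nbhs_subset x U lcX hausX
  (open_nbhs_nbhs (conj oU (xU x erefl) : open_nbhs x U)).
exists C => //; apply: le_lt_trans (dtm_tilde_le_dtm _ cC) _.
by apply: le_lt_trans finU; exact: dtm_compact_le_open.
Qed.

Lemma dtm_tilde_le_set_plus (K : set X) :
  compact K -> dtm_tilde nu K <= set_plus (dtm_tilde nu) K.
Proof.
move=> cK; rewrite set_plus_closedE; last exact: compact_closed.
apply: le_ereal_inf_tmp => _ [U [oU KU] <-].
by apply: ereal_sup_ubound; exists K.
Qed.

Lemma set_plus_le_dtm_tilde (K C : set X) :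
  compact K -> K `<=` C^° -> set_plus (dtm_tilde nu) K <= dtm_tilde nu C.
Proof.
move=> cK KC; rewrite set_plus_closedE; last exact: compact_closed.
apply: (@le_trans _ _ (plus_open (dtm_tilde nu) C^°)).
  by apply: ereal_inf_lbound; exists C^° => //; split=> //; exact: open_interior.
apply: ge_ereal_sup => _ [L [_ LC] <-]; apply: dtm_tilde_le.
by apply: subset_trans LC _; exact: interior_subset.
Qed.

End deficient_topological_measure_theory.

Theorem theorem3p9 (R : realType) (X : topologicalType)
  (lcX : locally_compact [set: X]) (connX : connected [set: X])
  (hausX : hausdorff_space X)
  (nu : set X -> \bar R) (hnu : deficient_topological_measure nu) :
  [<-> singleton_finite nu;
       compact_finite (dtm_tilde nu);
       compact_finite (set_plus (dtm_tilde nu))].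
Proof.
tfae.
- move=> nu1 K cK; rewrite ge0_fin_numE; last exact: dtm_tilde_ge0.
  exact: dtm_tilde_compact_lty.
- move=> tfin K cK.
  have [C cC KC] := compact_sub_interior_compact K lcX cK.
  rewrite ge0_fin_numE.
    apply: (le_lt_trans (set_plus_le_dtm_tilde hausX nu K C cK KC)).
    by rewrite ltey_eq tfin.
  by apply: le_trans (dtm_tilde_le_set_plus hausX nu K cK); exact: dtm_tilde_ge0.
- move=> mfin x; have c1 : compact [set x] by exact: compact_set1.
  rewrite ge0_fin_numE; last exact: dtm_compact_ge0.
  apply: le_lt_trans (dtm_le_dtm_tilde_set1 hausX nu hnu x) _.
  apply: le_lt_trans (dtm_tilde_le_set_plus hausX nu _ c1) _.
  by rewrite ltey_eq mfin.
Qed.
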